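(* Let $d\geqslant 2$ be an even integer and $a,e$ indeterminates. Let $n$ be a positive integer with $n\equiv d+1\pmod{2d}$. Then, modulo $\Phi_n(q)(1-aq^n)(a-q^n)$, \[ \sum_{k=0}^{(dn+n-1)/(2d)}[3d k+1] \frac{(q, e, q^{1+d} / e ; q^{2 d})_{k}\,(a q, q / a, q^{d-1} ; q^{d})_{k}} {(q^{d}, e, q^{1+d} / e ; q^{d})_{k}\,(a q^{2 d}, q^{2 d} / a, q^{d+2} ; q^{2 d})_{k}}\, q^{dk} \equiv 0. \]
   Context: For an expression $x$ and a base $p$, $(x;p)_k=(1-x)(1-xp)\cdots(1-xp^{k-1})$ (with $(x;p)_0=1$), and $(x_1,\dots,x_m;p)_k=(x_1;p)_k\cdots(x_m;p)_k$. The $q$-integer is $[m]=(1-q^m)/(1-q)$. $\Phi_n(q)$ denotes the $n$-th cyclotomic polynomial in $q$. Two rational functions $A,B$ in $q,a,e$ are congruent modulo a polynomial $P$ if $P$ divides the numerator of the reduced form of $A-B$ in the polynomial ring over $\mathbb{Z}$ (the denominators being coprime to $P$). *)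

(* Defs.v *)
From mathcomp Require Import all_boot all_order all_algebra all_field.

Set Implicit Arguments.
Unset Strict Implicit.
Unset Printing Implicit Defensive.

Import GRing.Theory.
Local Open Scope ring_scope.

Definition qpoch (F : fieldType) (x p : F) (k : nat) : F :=
  \prod_(j < k) (1 - x * p ^+ j).

(* (x_1, ..., x_m; p)_k, with xs = [:: x_1; ...; x_m] *)
Definition qpochs (F : fieldType) (xs : seq F) (p : F) (k : nat) : F :=
  \prod_(x <- xs) qpoch x p k.

Definition qint (F : fieldType) (q : F) (m : nat) : F :=
  (1 - q ^+ m) / (1 - q).

(* The polynomial ring Z[q, a, e] as Z[q][a][e]: q is the innermost variable
   and e the outermost one. *)
Notation Zqae := {poly {poly {poly int}}}.

Definition qX : Zqae := 'X%:P%:P.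
Definition aX : Zqae := 'X%:P.
Definition eX : Zqae := 'X.

Definition Phi (n : nat) : Zqae := ('Phi_n)%:P%:P.

Notation ratfun := {fraction Zqae}.

(* Divisibility in the ring itself; polydiv's %| is pseudo-divisibility when
   the coefficients do not form a field, so it is not the right notion here. *)
Definition divides (R : idomainType) (x y : R) : Prop := exists z, y = x * z.

Definition no_common_factor (R : idomainType) (x y : R) : Prop :=
  forall c, divides c x -> divides c y -> c \is a GRing.unit.

(* A is congruent to B modulo P: in the reduced form N / D of A - B (unique up
   to units), P divides N and D is coprime to P. *)
Definition congr_mod (P : Zqae) (A B : ratfun) : Prop :=
  exists N D : Zqae,
    [/\ D != 0, A - B = tofrac N / tofrac D, no_common_factor N D,
        divides P N & no_common_factor D P].

(* Main.v *)
From HB Require Import structures.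
Require Import Defs.
From mathcomp Require Import all_boot all_order all_algebra all_field.
From mathcomp Require Import ring zify.
From Stdlib Require Import Classical.

(** The three factors of the modulus are primes of Z[q, a, e]: each generates the
    kernel of an evaluation in a field (q a primitive n-th root of unity, a = q^-n,
    a = q^n), so it suffices that the sum vanishes under each evaluation.
    With p = q^d, b = q^(d-1), c = aq, g = q/a, f = q^(1+d)/e the summand is, up to
    the factor 1 / (1 - q), that of Rahman's quadratic series,
    (1 - al p^(3k)) (al, e, f; p^2)_k (b, c, g; p)_k
       / ((p, e, f; p)_k (cgp, bgp, bcp; p^2)_k) p^k,
    where al = q, al p = b c g = e f. A combination of the partial sums with
    parameters (al, b, f) and (al p^2, b p^2, f p^2) telescopes; when
    al p^(2M) = 1 or b p^(2i+1) = 1, the boundary term is zero and induction on M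
    or i shows that the sum is zero. *)

Set Implicit Arguments.
Unset Strict Implicit.
Unset Printing Implicit Defensive.

Import GRing.Theory.
Local Open Scope ring_scope.

(** * Elementary rules for q-Pochhammer symbols *)

Lemma qpoch0 (F : fieldType) (x p : F) : qpoch x p 0 = 1.
Proof. by rewrite /qpoch big_ord0. Qed.

Lemma qpochSr (F : fieldType) (x p : F) k :
  qpoch x p k.+1 = qpoch x p k * (1 - x * p ^+ k).
Proof. by rewrite /qpoch big_ord_recr. Qed.

Lemma qpochSl (F : fieldType) (x p : F) k :
  qpoch x p k.+1 = (1 - x) * qpoch (x * p) p k.
Proof.
rewrite /qpoch big_ord_recl /= expr0 mulr1; congr (_ * _).
by apply: eq_bigr => i _; rewrite exprS mulrA.
Qed.

Lemma qpoch_eq0 (F : fieldType) (x p : F) j k :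
  x * p ^+ j = 1 -> (j < k)%N -> qpoch x p k = 0.
Proof.
move=> h jk; apply/eqP/prodf_eq0.
by exists (Ordinal jk) => //=; rewrite h subrr.
Qed.

(** * Rahman's quadratic series: telescoping and vanishing *)

Definition rterm (F : fieldType) (p al b c g e f : F) (k : nat) : F :=
  (1 - al * p ^+ (3 * k)) *
  ((qpoch al (p ^+ 2) k * qpoch e (p ^+ 2) k * qpoch f (p ^+ 2) k
    * (qpoch b p k * qpoch c p k * qpoch g p k))
   / (qpoch p p k * qpoch e p k * qpoch f p k
      * (qpoch (c * g * p) (p ^+ 2) k * qpoch (b * g * p) (p ^+ 2) k
         * qpoch (b * c * p) (p ^+ 2) k))) * p ^+ k.

(** Telescoping certificate. Its factors [(al; p^2)_(k+1)] and [(b p; p)_k] are the ones that vanish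
    in the two terminating cases. *)
Definition rcert (F : fieldType) (p al b c g e f : F) (k : nat) : F :=
  f * p * (1 - f * b * p ^+ 2 * (p ^+ k) ^+ 2)
  * (qpoch al (p ^+ 2) k.+1 * qpoch e (p ^+ 2) k.+1 * qpoch f (p ^+ 2) k.+1
     * (qpoch (b * p) p k * qpoch c p k.+1 * qpoch g p k.+1))
  / (qpoch p p k * qpoch e p k * qpoch f p k.+2
      * (qpoch (c * g * p) (p ^+ 2) k * qpoch (b * g * p) (p ^+ 2) k.+1
         * qpoch (b * c * p) (p ^+ 2) k.+1)).

(** Weight of the shifted series. The factors other than [f p - c] and [f p - g] extend the shifted
    Pochhammer symbols downwards, to the parameters [al], [b p], [f], [b g p], [b c p]; the two
    factors [1 - f] that arise cancel. *)
Definition rcoef (F : fieldType) (p al b c g f : F) : F :=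
  (f * p - c) * (f * p - g) * (1 - al) * (1 - b * p)
  / ((1 - f * p) * (1 - b * g * p) * (1 - b * c * p)).

(** The increment of the certificate once the common Pochhammer symbols are divided out, at
    [y = p^K] and [x = p^(K+1)]. *)
Lemma rahman_step_identity (R : comPzRingType) (p y b c g e f al : R) :
  al * p = b * c * g -> e * f = b * c * g ->
  let x := y * p in
  (f * p - c * g) * ((1 - al * x ^+ 3) * (1 - b) * (1 - f * x) * (1 - f * x * p)
     * (1 - b * g * p * x ^+ 2) * (1 - b * c * p * x ^+ 2) * x)
  + (f * p - c) * (f * p - g) * (1 - al * p ^+ 2 * x ^+ 3) * (1 - al * x ^+ 2)
     * (1 - f * x ^+ 2) * (1 - b * x) * (1 - b * x * p) * x
  + f * p * (1 - f * b * x ^+ 2) * (1 - x) * (1 - e * y) * (1 - f * x * p)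
     * (1 - c * g * x * y) * (1 - b * g * p * x ^+ 2) * (1 - b * c * p * x ^+ 2)
  = f * p * (1 - f * b * p ^+ 2 * x ^+ 2) * (1 - al * x ^+ 2) * (1 - e * x ^+ 2)
     * (1 - f * x ^+ 2) * (1 - b * x) * (1 - c * x) * (1 - g * x).
Proof.
move=> h1 h2 x.
(* [al] always meets a factor [p], and [e] a factor [f], so the two balancing conditions eliminate
   both and leave an identity in free variables. *)
have a2 : al * x ^+ 2 = b * c * g * y * x by rewrite -h1 /x; ring.
have a3 : al * x ^+ 3 = b * c * g * y * x ^+ 2 by rewrite -h1 /x; ring.
have a4 : al * p ^+ 2 * x ^+ 3 = b * c * g * p * x ^+ 3 by rewrite -h1; ring.
have e1 z u : f * p * z * u * (1 - e * x ^+ 2)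
    = (f * p - b * c * g * p * x ^+ 2) * z * u by rewrite -h2; ring.
have e2 : f * p * (1 - f * b * x ^+ 2) * (1 - x) * (1 - e * y)
    = (f * p - b * c * g * x) * (1 - f * b * x ^+ 2) * (1 - x).
  by rewrite -h2 /x; ring.
by rewrite a2 a3 a4 e2 e1 /x; ring.
Qed.

Lemma rcoef_rterm (F : fieldType) (p al b c g e f : F) k :
  (forall j, f * p ^+ j != 1) -> (forall j, b * g * p * (p ^+ 2) ^+ j != 1) ->
  (forall j, b * c * p * (p ^+ 2) ^+ j != 1) ->
  rcoef p al b c g f * rterm p (al * p ^+ 2) (b * p ^+ 2) c g e (f * p ^+ 2) k
  = (f * p - c) * (f * p - g) * (1 - al * p ^+ 2 * (p ^+ k) ^+ 3)
    * (qpoch al (p ^+ 2) k.+1 * qpoch e (p ^+ 2) k * qpoch f (p ^+ 2) k.+1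
       * (qpoch (b * p) p k.+1 * qpoch c p k * qpoch g p k))
    / (qpoch p p k * qpoch e p k * qpoch f p k.+2
      * (qpoch (c * g * p) (p ^+ 2) k * qpoch (b * g * p) (p ^+ 2) k.+1
         * qpoch (b * c * p) (p ^+ 2) k.+1)) * p ^+ k.
Proof.
move=> hf hbg hbc.
have n1 (x : F) : x != 1 -> 1 - x != 0 by rewrite subr_eq0 eq_sym.
have := n1 _ (hf 0%N); rewrite expr0 mulr1 => nf.
have := n1 _ (hf 1%N); rewrite expr1 => nfp.
have := n1 _ (hbg 0%N); rewrite expr0 mulr1 => nbg.
have := n1 _ (hbc 0%N); rewrite expr0 mulr1 => nbc.
rewrite /rterm /rcoef !(qpochSl al) !(qpochSl f) !(qpochSl (b * p)) !(qpochSl (f * p)).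
rewrite !(qpochSl (b * g * p)) !(qpochSl (b * c * p)).
have -> : b * p * p = b * p ^+ 2 by ring.
have -> : f * p * p = f * p ^+ 2 by ring.
have -> : b * p ^+ 2 * g * p = b * g * p * p ^+ 2 by ring.
have -> : b * p ^+ 2 * c * p = b * c * p * p ^+ 2 by ring.
rewrite mulnC exprM !invfM.
(* These inverses occur alike on both sides; as variables they require no nonvanishing condition
   from [field]. *)
move: (qpoch p p k)^-1 (qpoch e p k)^-1 (qpoch (f * p ^+ 2) p k)^-1
  (qpoch (c * g * p) _ k)^-1 (qpoch (b * g * p * _) _ k)^-1
  (qpoch (b * c * p * _) _ k)^-1 => X1 X2 X3 X4 X5 X6.
by field; rewrite nf nfp nbg nbc.
Qed.

(** For [p] and [c g p] only the index [K] is constrained: at a root of unity both are powers of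
    [q], and later factors may vanish. *)
Lemma rcert_step (F : fieldType) (p al b c g e f : F) K :
  al * p = b * c * g -> e * f = b * c * g ->
  p * p ^+ K != 1 ->
  (forall j, e * p ^+ j != 1) -> (forall j, f * p ^+ j != 1) ->
  c * g * p * (p ^+ 2) ^+ K != 1 ->
  (forall j, b * g * p * (p ^+ 2) ^+ j != 1) ->
  (forall j, b * c * p * (p ^+ 2) ^+ j != 1) ->
  rcert p al b c g e f K +
  ((f * p - c * g) * rterm p al b c g e f K.+1 +
   rcoef p al b c g f
     * rterm p (al * p ^+ 2) (b * p ^+ 2) c g e (f * p ^+ 2) K.+1)
  = rcert p al b c g e f K.+1.
Proof.
move=> h1 h2 hp he hf hcg hbg hbc.
rewrite rcoef_rterm // /rcert /rterm.
have n1 (x : F) : x != 1 -> 1 - x != 0 by rewrite subr_eq0 eq_sym.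
rewrite mulnC [in 1 - al * p ^+ _]exprM.
rewrite !(qpochSr f p K.+2) !(qpochSr f p K.+1) !(qpochSr f _ K.+1).
rewrite !(qpochSr al _ K.+1) !(qpochSr e (p ^+ 2) K.+1) !(qpochSr e p K).
rewrite !(qpochSr (b * p) _ K.+1) !(qpochSr (b * p) _ K) !(qpochSr c _ K.+1).
rewrite !(qpochSr g _ K.+1) !(qpochSr p _ K).
rewrite (qpochSl b).
rewrite !(qpochSr (c * g * p) _ K).
rewrite !(qpochSr (b * g * p) _ K.+1).
rewrite !(qpochSr (b * c * p) _ K.+1).
have := rahman_step_identity (p ^+ K) h1 h2.
cbv zeta.
set y := p ^+ K.
have y1 : p ^+ K.+1 = y * p by rewrite exprSr.
have y2 : p ^+ K.+2 = y * p * p by rewrite exprSr y1.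
have z0 : (p ^+ 2) ^+ K = y * y by rewrite exprAC expr2.
have z1 : (p ^+ 2) ^+ K.+1 = (y * p) ^+ 2 by rewrite exprAC y1.
have := n1 _ hp; rewrite -/y => m1.
have := n1 _ (he K); rewrite -/y => m2.
have := n1 _ (hf K.+1); rewrite y1 => m3.
have := n1 _ (hf K.+2); rewrite y2 => m4.
have := n1 _ hcg; rewrite z0 => m5.
have := n1 _ (hbg K.+1); rewrite z1 => m6.
have := n1 _ (hbc K.+1); rewrite z1 => m7.
move=> id.
rewrite !invfM.
move: (qpoch p p K)^-1 (qpoch e p K)^-1 (qpoch f p K.+1)^-1
  (qpoch (c * g * p) _ K)^-1 (qpoch (b * g * p) _ K.+1)^-1
  (qpoch (b * c * p) _ K.+1)^-1 => X1 X2 X3 X4 X5 X6.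
(* [N] collects the factors common to all terms and [W] divides it by the denominator factors split
   off above; what multiplies [W] is [rahman_step_identity]. *)
pose N := qpoch al (p ^+ 2) K.+1 * qpoch e (p ^+ 2) K.+1 * qpoch f (p ^+ 2) K.+1
  * (qpoch (b * p) p K * qpoch c p K.+1 * qpoch g p K.+1) * (X1 * X2 * X3 * X4 * X5 * X6).
pose W := N / ((1 - p * y) * (1 - e * y) * (1 - f * (y * p)) * (1 - f * (y * p * p))
  * (1 - c * g * p * (y * y)) * (1 - b * g * p * (y * p) ^+ 2)
  * (1 - b * c * p * (y * p) ^+ 2)).
transitivity (W * ((f * p * (1 - f * b * (y * p) ^+ 2) * (1 - y * p) * (1 - e * y)
    * (1 - f * (y * p) * p) * (1 - c * g * (y * p) * y)
    * (1 - b * g * p * (y * p) ^+ 2) * (1 - b * c * p * (y * p) ^+ 2))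
  + ((f * p - c * g) * ((1 - al * (y * p) ^+ 3) * (1 - b) * (1 - f * (y * p))
      * (1 - f * (y * p) * p) * (1 - b * g * p * (y * p) ^+ 2)
      * (1 - b * c * p * (y * p) ^+ 2) * (y * p))
  + (f * p - c) * (f * p - g) * (1 - al * p ^+ 2 * (y * p) ^+ 3)
     * (1 - al * (y * p) ^+ 2) * (1 - f * (y * p) ^+ 2) * (1 - b * (y * p))
     * (1 - b * (y * p) * p) * (y * p)))).
  rewrite !mulrDr /W /N; congr (_ + (_ + _)).
  - by field; rewrite m1 m2 m3 m4 m5 m6 m7.
  - by field; rewrite m1 m2 m3 m4 m5 m6 m7.
  - by field; rewrite m1 m2 m3 m4 m5 m6 m7.
rewrite addrC id /W /N.
by field; rewrite m1 m2 m3 m4 m5 m6 m7.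
Qed.

Lemma rahman_sum (F : fieldType) (p al b c g e f : F) K :
  al * p = b * c * g -> e * f = b * c * g ->
  (forall j, (j < K)%N -> p * p ^+ j != 1) ->
  (forall j, e * p ^+ j != 1) -> (forall j, f * p ^+ j != 1) ->
  (forall j, (j < K)%N -> c * g * p * (p ^+ 2) ^+ j != 1) ->
  (forall j, b * g * p * (p ^+ 2) ^+ j != 1) ->
  (forall j, b * c * p * (p ^+ 2) ^+ j != 1) ->
  (f * p - c * g) * (\sum_(0 <= k < K.+1) rterm p al b c g e f k)
  + rcoef p al b c g f * (\sum_(0 <= k < K.+1)
      rterm p (al * p ^+ 2) (b * p ^+ 2) c g e (f * p ^+ 2) k)
  = rcert p al b c g e f K.
Proof.
move=> h1 h2 hp he hf hcg hbg hbc; elim: K hp hcg => [|K IH] hp hcg.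
  rewrite !big_nat1 rcoef_rterm // /rterm /rcert !qpochSr !qpoch0 !expr0 expr1.
  have n1 (x : F) : x != 1 -> 1 - x != 0 by rewrite subr_eq0 eq_sym.
  have := n1 _ (hf 0%N); rewrite expr0 mulr1 => nf.
  have := n1 _ (hf 1%N); rewrite expr1 => nfp.
  have := n1 _ (hbg 0%N); rewrite expr0 mulr1 => nbg.
  have := n1 _ (hbc 0%N); rewrite expr0 mulr1 => nbc.
  have ap : al * p ^+ 2 = b * c * g * p by rewrite -h1; ring.
  rewrite !mul1r !expr1n !mulr1 ap.
  (* Writing [f (1 - e)] as [f - e f] exposes the product [e f] to the balancing condition. *)
  transitivity ((f - e * f) * (p * (1 - f * (b * p ^+ 2)) * (1 - al) * (1 - c)
      * (1 - g) / ((1 - f * p) * (1 - b * g * p) * (1 - b * c * p)))); last first.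
    by field; rewrite nf nfp nbg nbc.
  by rewrite h2; field; rewrite nf nfp nbg nbc oner_eq0.
rewrite !(big_nat_recr K.+1) //= -rcert_step //; last 2 first.
  - exact: hp.
  - exact: hcg.
rewrite -IH => [|j jK|j jK]; [ring | exact/hp/ltnW | exact/hcg/ltnW].
Qed.

(** Induction on [M]: [(al; p^2)_(M+1) = 0] kills the certificate at [M], the shifted series meets
    the condition for [M - 1], and the factor [f p - c g] left before the sum is nonzero. *)
Lemma rahman_sum_eq0_al (F : fieldType) (p al b c g e f : F) M :
  al * p = b * c * g -> e * f = b * c * g -> al * p ^+ (2 * M) = 1 ->
  (forall j, (j < M)%N -> p * p ^+ j != 1) ->
  (forall j, e * p ^+ j != 1) -> (forall j, f * p ^+ j != 1) ->
  (forall j, (j < M)%N -> c * g * p * (p ^+ 2) ^+ j != 1) ->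
  (forall j, b * g * p * (p ^+ 2) ^+ j != 1) ->
  (forall j, b * c * p * (p ^+ 2) ^+ j != 1) ->
  (forall j, f * p ^+ j != c * g) ->
  \sum_(0 <= k < M.+1) rterm p al b c g e f k = 0.
Proof.
elim: M al b f => [|M IH] al b f h1 h2 h3 hp he hf hcg hbg hbc hfc.
  move: h3; rewrite muln0 expr0 mulr1 => al1.
  by rewrite big_nat1 /rterm muln0 expr0 al1 mulr1 subrr !mul0r.
have /(_ M.+1) := rahman_sum h1 h2 _ he hf _ hbg hbc.
move=> /(_ hp hcg).
have al_eq0 j : (M.+1 < j)%N -> qpoch al (p ^+ 2) j = 0.
  by move=> Mj; apply: qpoch_eq0 Mj; rewrite -exprM.
have -> : rcert p al b c g e f M.+1 = 0 by rewrite /rcert al_eq0 // !(mul0r, mulr0).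
rewrite [X in rcoef _ _ _ _ _ _ * X]big_nat_recr //= IH; first last.
- by move=> j; rewrite -mulrA -exprD.
- move=> j; have -> : b * p ^+ 2 * c * p = b * c * p * p ^+ 2 by ring.
  by rewrite -mulrA -exprS.
- move=> j; have -> : b * p ^+ 2 * g * p = b * g * p * p ^+ 2 by ring.
  by rewrite -mulrA -exprS.
- by move=> j jM; apply/hcg/ltnW.
- by move=> j; rewrite -mulrA -exprD.
- by [].
- by move=> j jM; apply/hp/ltnW.
- by rewrite -mulrA -exprD -h3 mulnS.
- by rewrite mulrA h2; ring.
- have -> : al * p ^+ 2 * p = al * p * p ^+ 2 by ring.
  by rewrite h1; ring.
(* The shifted sum has one term more than the induction hypothesis covers; that term contains
   [1 - al p^(2 M + 2) = 0]. *)
have -> : rterm p (al * p ^+ 2) (b * p ^+ 2) c g e (f * p ^+ 2) M.+1 = 0.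
  rewrite /rterm (qpoch_eq0 (j := M)) ?(mul0r, mulr0) //.
  by rewrite -exprM -mulrA -exprD -h3 mulnS.
rewrite addr0 mulr0 addr0 => /eqP; rewrite mulf_eq0 subr_eq0.
by have /negbTE := hfc 1%N; rewrite expr1 => -> /eqP.
Qed.

(** Induction on [i] with [K] fixed: [(b p; p)_K] contains [1 - b p^(2 i + 1)] because [2 i < K],
    and the shift lowers [i] by one. At [i = 0] the weight [rcoef] vanishes through [1 - b p]. *)
Lemma rahman_sum_eq0_b (F : fieldType) (p al b c g e f : F) i K :
  al * p = b * c * g -> e * f = b * c * g -> b * p ^+ (2 * i + 1) = 1 ->
  (2 * i < K)%N ->
  (forall j, (j < K)%N -> p * p ^+ j != 1) ->
  (forall j, e * p ^+ j != 1) -> (forall j, f * p ^+ j != 1) ->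
  (forall j, (j < K)%N -> c * g * p * (p ^+ 2) ^+ j != 1) ->
  (forall j, b * g * p * (p ^+ 2) ^+ j != 1) ->
  (forall j, b * c * p * (p ^+ 2) ^+ j != 1) ->
  (forall j, f * p ^+ j != c * g) ->
  \sum_(0 <= k < K.+1) rterm p al b c g e f k = 0.
Proof.
move=> + + + + hp he + hcg.
elim: i al b f => [|i IH] al b f h1 h2 h3 iK hf hbg hbc hfc.
  have := rahman_sum h1 h2 hp he hf hcg hbg hbc.
  move: h3; rewrite muln0 expr1 => b1.
  rewrite /rcoef b1 subrr mulr0 !mul0r addr0 /rcert b1.
  rewrite (qpoch_eq0 (x := 1) (j := 0)) ?mulr1 //.
  rewrite !(mul0r, mulr0) => /eqP; rewrite mulf_eq0 subr_eq0.
  by have /negbTE := hfc 1%N; rewrite expr1 => -> /eqP.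
have := rahman_sum h1 h2 hp he hf hcg hbg hbc.
have -> : rcert p al b c g e f K = 0.
  rewrite /rcert (qpoch_eq0 (x := b * p) (j := (2 * i.+1)%N)) ?(mul0r, mulr0) //.
  by rewrite -mulrA -exprS -addn1.
rewrite (IH (al * p ^+ 2) (b * p ^+ 2) (f * p ^+ 2)); first last.
- by move=> j; rewrite -mulrA -exprD.
- move=> j; have -> : b * p ^+ 2 * c * p = b * c * p * p ^+ 2 by ring.
  by rewrite -mulrA -exprS.
- move=> j; have -> : b * p ^+ 2 * g * p = b * g * p * p ^+ 2 by ring.
  by rewrite -mulrA -exprS.
- by move=> j; rewrite -mulrA -exprD.
- by apply: ltn_trans iK; rewrite ltn_pmul2l.
- by rewrite -mulrA -exprD -h3 mulnS.
- by rewrite mulrA h2; ring.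
- have -> : al * p ^+ 2 * p = al * p * p ^+ 2 by ring.
  by rewrite h1; ring.
rewrite mulr0 addr0 => /eqP; rewrite mulf_eq0 subr_eq0.
by have /negbTE := hfc 1%N; rewrite expr1 => -> /eqP.
Qed.

(** * Existence of reduced forms *)

(** A size that drops strictly when a nonunit factor is cancelled; descent on it replaces the use of
    a gcd in [Z[q, a, e]]. *)
Definition size_like (R : idomainType) (mu : R -> nat) : Prop :=
  forall x c : R, x != 0 -> c != 0 ->
    (mu x <= mu (x * c)%R)%N /\ ((mu (x * c)%R <= mu x)%N -> c \is a GRing.unit).

Lemma size_like_absz : size_like (fun x : int => `|x|%N).
Proof.
move=> x c x0 c0; rewrite abszM.
have x1 : (0 < `|x|)%N by rewrite absz_gt0.
have c1 : (0 < `|c|)%N by rewrite absz_gt0.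
split; first by rewrite leq_pmulr.
rewrite -{2}[`|x|%N]muln1 leq_pmul2l // => c2.
have /eqP : `|c|%N == 1%N by rewrite eqn_leq c2 c1.
by rewrite qualifE /=; case: c {c0 c1 c2} => [[|[]]|[]].
Qed.

(** Neither summand decreases under multiplication by [c]. If the total does not grow, neither does
    either summand, so [c] is constant and its coefficient is a unit by the hypothesis on [mu]. *)
Lemma size_like_poly (R : idomainType) (mu : R -> nat) :
  size_like mu -> size_like (fun p : {poly R} => size p + mu (lead_coef p))%N.
Proof.
move=> h x c x0 c0.
have [] := h (lead_coef x) (lead_coef c); rewrite ?lead_coef_eq0 // -lead_coefM.
move=> h1 h2; have c1 : (0 < size c)%N by rewrite size_poly_gt0.
have x1 : (0 < size x)%N by rewrite size_poly_gt0.
have le1 : (size x <= size (x * c)%R)%N.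
  by rewrite size_mul // -ltnS prednK ?addn_gt0 ?x1 // -addn1 leq_add2l.
split; first exact: leq_add.
move=> le2; have le3 : (size (x * c)%R <= size x)%N.
  by rewrite -(leq_add2r (mu (lead_coef x))) (leq_trans _ le2) // leq_add2l.
have le4 : (mu (lead_coef (x * c)%R) <= mu (lead_coef x))%N.
  by rewrite -(leq_add2l (size x)) (leq_trans _ le2) // leq_add2r.
have c2 : size c == 1%N.
  rewrite eqn_leq c1 andbT; move: le3; rewrite size_mul // -ltnS prednK.
    by rewrite -addn1 leq_add2l.
  by rewrite addn_gt0 x1.
rewrite poly_unitE c2 /=.
by have := h2 le4; rewrite lead_coefE (eqP c2).
Qed.

(** Strong induction on [mu D], which drops each time a common nonunit factor is cancelled. *)
Lemma ex_reduced_form (R : idomainType) (mu : R -> nat) (N D : R) :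
  size_like mu -> D != 0 ->
  exists g N1 D1, [/\ N = g * N1, D = g * D1 & no_common_factor N1 D1].
Proof.
move=> hmu; have [m] := ubnP (mu D); elim: m N D => // m IH N D Dm D0.
case: (classic (no_common_factor N D)) => [nc|].
  by exists 1, N, D; rewrite !mul1r.
move=> nc; have [c hc] := not_all_ex_not _ _ nc.
have [[N' cN] {}hc] := imply_to_and _ _ hc.
have [[D' cD] nu] := imply_to_and _ _ hc.
have c0 : c != 0 by apply: contraNneq D0 => c0; rewrite cD c0 mul0r.
have D'0 : D' != 0 by apply: contraNneq D0 => c1; rewrite cD c1 mulr0.
have [|g [N1 [D1 [h1 h2 h3]]]] := IH N' D' _ D'0.
  suff lt1 : (mu D' < mu D)%N by rewrite (leq_trans lt1) // -ltnS.
  rewrite ltnNge; apply/negP => le1; apply: nu.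
  by have [_] := hmu D' c D'0 c0; apply; rewrite mulrC -cD.
by exists (c * g), N1, D1; rewrite -!mulrA -h1 -h2.
Qed.

(** * Primes as kernels of evaluations *)

(** The ideal of [x] is the kernel of [h]. With a field as target it is prime, and divisibility by
    [x] becomes a vanishing test. *)
Definition kernel_generator (R : idomainType) (S : pzRingType) (h : R -> S) (x : R)
  : Prop := h x = 0 /\ forall y, h y = 0 -> divides x y.

Lemma kernel_generator_prime (R : idomainType) (F : fieldType)
    (h : {rmorphism R -> F}) (x y z : R) :
  kernel_generator h x -> h y != 0 -> divides x (y * z) -> divides x z.
Proof.
move=> [hx hk] hy [t yz]; apply: hk.
have : h (y * z) = 0 by rewrite yz rmorphM hx mul0r.
by move/eqP; rewrite rmorphM mulf_eq0 (negbTE hy) => /eqP.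
Qed.

(** [h2 x1 != 0] says that [x2] does not divide [x1], and similarly for [x3], so each further prime
    passes to the cofactor. *)
Lemma divides_prod3 (R : idomainType) (F1 F2 F3 : fieldType)
    (h1 : {rmorphism R -> F1}) (h2 : {rmorphism R -> F2}) (h3 : {rmorphism R -> F3})
    (x1 x2 x3 y : R) :
  kernel_generator h1 x1 -> kernel_generator h2 x2 -> kernel_generator h3 x3 ->
  h2 x1 != 0 -> h3 (x1 * x2) != 0 ->
  divides x1 y -> divides x2 y -> divides x3 y -> divides (x1 * x2 * x3) y.
Proof.
move=> k1 k2 k3 n12 n123 [z ->] d2 d3.
have [w hw] := kernel_generator_prime k2 n12 d2.
move: d3; rewrite hw mulrA => d3.
have [v ->] := kernel_generator_prime k3 n123 d3.
by exists v; rewrite !mulrA.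
Qed.

(** If [N0 = g N] and [D0 = g D], no evaluation kills [g] since none kills [D0]; hence each prime,
    dividing [N0], divides [N]. *)
Lemma reduced_form_mod_prod3 (R : idomainType) (mu : R -> nat) (F1 F2 F3 : fieldType)
    (h1 : {rmorphism R -> F1}) (h2 : {rmorphism R -> F2}) (h3 : {rmorphism R -> F3})
    (x1 x2 x3 N0 D0 : R) :
  size_like mu ->
  kernel_generator h1 x1 -> kernel_generator h2 x2 -> kernel_generator h3 x3 ->
  h2 x1 != 0 -> h3 (x1 * x2) != 0 -> x3 != 0 ->
  h1 N0 = 0 -> h2 N0 = 0 -> h3 N0 = 0 ->
  h1 D0 != 0 -> h2 D0 != 0 -> h3 D0 != 0 ->
  exists N D, [/\ D != 0, N0 * D = N * D0, no_common_factor N D,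
    divides (x1 * x2 * x3) N & no_common_factor D (x1 * x2 * x3)].
Proof.
move=> hmu k1 k2 k3 n12 n123 n3 z1 z2 z3 d1 d2 d3.
have D0n : D0 != 0 by apply: contraNneq d1 => ->; rewrite rmorph0.
have [g [N [D [eN eD nc]]]] := ex_reduced_form N0 hmu D0n.
have x_neq0 : x1 * x2 * x3 != 0.
  by rewrite mulf_neq0 //; apply: contraNneq n123 => ->; rewrite rmorph0.
have dvd (F : fieldType) (h : {rmorphism R -> F}) x :
    kernel_generator h x -> h N0 = 0 -> h D0 != 0 -> divides x N.
  move=> k z d; apply: (kernel_generator_prime (y := g) k).
    by apply: contraNneq d => g0; rewrite eD rmorphM g0 mul0r.
  by rewrite -eN; apply: k.2.
exists N, D; split => //.
- by apply: contraNneq D0n => z; rewrite eD z mulr0.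
- by rewrite eN eD; ring.
- apply: (divides_prod3 k1 k2 k3) => //.
  + exact: dvd k1 z1 d1.
  + exact: dvd k2 z2 d2.
  + exact: dvd k3 z3 d3.
(* A common divisor [c] of [D] and the modulus survives the three evaluations, so all primes divide
   the cofactor [z]; cancelling their product makes [c] a unit. *)
move=> c [D' cD] [z cz].
have ndvd (F : fieldType) (h : {rmorphism R -> F}) : h D0 != 0 -> h c != 0.
  by apply: contraNneq => c0; rewrite eD cD !rmorphM c0 mul0r mulr0.
have [|||w hw] := divides_prod3 (y := z) k1 k2 k3 n12 n123.
- apply: (kernel_generator_prime k1 (ndvd _ _ d1)).
  by rewrite -cz; exists (x2 * x3); rewrite mulrA.
- apply: (kernel_generator_prime k2 (ndvd _ _ d2)).
  by rewrite -cz; exists (x1 * x3); ring.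
- apply: (kernel_generator_prime k3 (ndvd _ _ d3)).
  by rewrite -cz; exists (x1 * x2); ring.
apply/unitrP; exists w.
suff cw : c * w = 1 by rewrite mulrC cw.
by apply: (mulfI x_neq0); rewrite mulr1 [RHS]cz hw; ring.
Qed.

Lemma kernel_generator_inj (R : idomainType) (S T : pzRingType)
    (h : {rmorphism R -> S}) (k : {rmorphism S -> T}) x :
  injective k -> kernel_generator h x -> kernel_generator (k \o h) x.
Proof.
move=> ik [hx hk]; split=> [|y]; first by rewrite /= hx rmorph0.
by rewrite /= -(rmorph0 k) => /ik /hk.
Qed.

Lemma kernel_generator_map_poly (R : idomainType) (S : nzRingType)
    (h : {rmorphism R -> S}) x :
  kernel_generator h x -> kernel_generator (map_poly h) x%:P.
Proof.
move=> [hx hk]; split=> [|y hy]; first by rewrite map_polyC /= hx.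
(* Boolean equality lets [xchoose] select a quotient for each coefficient. *)
have {}hk z : h z = 0 -> exists t, z == x * t by move=> /hk [t ->]; exists t.
have hc i : h y`_i = 0 by rewrite -coef_map hy coef0.
exists (\poly_(i < size y) xchoose (hk _ (hc i))).
apply/polyP => i; rewrite coefCM coef_poly; case: ltnP => iy.
  exact/eqP/(xchooseP (hk _ (hc i))).
by rewrite mulr0 nth_default.
Qed.

Lemma kernel_generator_eval (R : idomainType) (F : fieldType)
    (u : {rmorphism R -> F}) (x : R) :
  injective u ->
  kernel_generator (horner_eval (u x) \o map_poly u) ('X - x%:P).
Proof.
move=> iu; split=> [|y]; rewrite /= /horner_eval horner_map.
  by rewrite !hornerE subrr rmorph0.
rewrite -(rmorph0 u) => /iu /eqP/factor_theorem [z ->].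
by exists z; rewrite mulrC.
Qed.

(* Not a case of the factor theorem: [1 - x X] is not monic, so the division
   starts from the constant coefficient. *)
Lemma kernel_generator_eval_inv (R : idomainType) (F : fieldType)
    (u : {rmorphism R -> F}) (x : R) :
  injective u -> x != 0 ->
  kernel_generator (horner_eval (u x)^-1 \o map_poly u) (1 - x%:P * 'X).
Proof.
move=> iu x0; have ux0 : u x != 0 by rewrite -(rmorph0 u) (inj_eq iu).
split=> [|y].
  rewrite /= /horner_eval rmorphB rmorphM /= rmorph1 map_polyC map_polyX.
  by rewrite !hornerE divff ?subrr.
rewrite /= /horner_eval; have [m] := ubnP (size y); elim: m y => // m IH y ym hy.
have [sy|sy] := leqP (size y) 1.
  move: hy; rewrite (size1_polyC sy) map_polyC hornerC -(rmorph0 u) => /iu ->.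
  by exists 0; rewrite mulr0.
have [z ez] : exists z, y = (y`_0)%:P + 'X * z.
  have /factor_theorem [z ez] : root (y - (y`_0)%:P) 0.
    by rewrite /root !hornerE horner_coef0 subrr.
  by exists z; rewrite mulrC -(subr0 'X) -ez addrC subrK.
have sz : (size z < size y)%N.
  have [-> | z0] := eqVneq z 0; first by rewrite size_poly0 (leq_trans _ sy).
  rewrite -(size_mulX z0) -(addKr (y`_0)%:P (z * 'X)) (mulrC z) -ez.
  apply: leq_trans (size_polyD _ _) _; rewrite geq_max leqnn andbT size_polyN.
  by rewrite (leq_trans (size_polyC_leq1 _)) // ltnW.
(* With [y = y_0 + X z], vanishing at [1/x] passes to [z + y_0 x]; if the latter is [(1 - x X) t],
   then [y = (1 - x X) (y_0 + X t)]. *)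
have [||t et] := IH (z + (y`_0 * x)%:P).
- rewrite -ltnS (leq_trans _ ym) // ltnS.
  apply: leq_ltn_trans (size_polyD _ _) _; rewrite gtn_max sz /=.
  exact: leq_ltn_trans (size_polyC_leq1 _) sy.
- move: hy; rewrite {1}ez !rmorphD !rmorphM /= !map_polyC map_polyX !hornerE /=.
  move=> hy; apply: (mulfI (invr_neq0 ux0)); rewrite mulr0 -[RHS]hy.
  by field.
exists ((y`_0)%:P + 'X * t).
have -> : (1 - x%:P * 'X) * ((y`_0)%:P + 'X * t)
  = (1 - x%:P * 'X) * (y`_0)%:P + 'X * ((1 - x%:P * 'X) * t) by ring.
by rewrite -et {1}ez polyCM; ring.
Qed.

(** Division by the monic ['Phi_n] stays over the integers. The remainder has the root [z] and a
    degree below that of the minimal polynomial of [z] over the rationals, which is ['Phi_n], so it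
    is zero. *)
Lemma kernel_generator_Cyclotomic n (z : algC) :
  n.-primitive_root z ->
  kernel_generator (horner_eval z \o map_poly (intr : int -> algC)) 'Phi_n.
Proof.
move=> pz; have cz : root (map_poly intr 'Phi_n) z.
  by rewrite (Cintr_Cyclotomic pz) -(minCpoly_cyclotomic pz) root_minCpoly.
split=> [|y]; rewrite /= /horner_eval; first exact/eqP.
have mPhi := Cyclotomic_monic n.
have nPhi : 'Phi_n != 0 by rewrite monic_neq0.
rewrite (Pdiv.RingMonic.rdivp_eq mPhi y).
have := Pdiv.CommonRing.ltn_rmodpN0 y nPhi.
set r := Pdiv.CommonRing.rmodp _ _; set s := Pdiv.CommonRing.rdivp _ _ => r_lt.
rewrite rmorphD rmorphM hornerD hornerM (eqP cz) mulr0 add0r => rz.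
suff -> : r = 0 by exists s; rewrite addr0 mulrC.
apply/eqP; apply: contraTT r_lt => r0; rewrite -leqNgt.
have [p [ep _] hp] := minCpolyP z.
have inj_int : injective (intr : int -> rat) by apply: intr_inj.
have er : map_poly ratr (map_poly intr r : {poly rat}) = map_poly intr r :> {poly algC}.
  by rewrite -map_poly_comp; apply: eq_map_poly => i /=; rewrite ratr_int.
have : p %| map_poly intr r by rewrite -hp er; apply/eqP.
move=> /dvdp_leq; rewrite map_poly_eq0_id0 ?intr_eq0 ?lead_coef_eq0 // => /(_ r0).
rewrite (size_map_inj_poly inj_int) // -(size_map_poly (ratr : rat -> algC)) -ep.
rewrite (minCpoly_cyclotomic pz) -(Cintr_Cyclotomic pz) size_map_inj_poly //.
exact: intr_inj.
Qed.

(** * The summand as a quotient of polynomials *)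

(** Homogeneous form [y^k (x/y; p)_k] of the Pochhammer symbol: free of division, it makes sense in
    [Z[q, a, e]] and commutes with evaluations. *)
Definition qprod (R : comPzRingType) (x y p : R) (k : nat) : R :=
  \prod_(j < k) (y - x * p ^+ j).

Lemma rmorph_qprod (R S : comPzRingType) (h : {rmorphism R -> S}) x y p k :
  h (qprod x y p k) = qprod (h x) (h y) (h p) k.
Proof.
by rewrite rmorph_prod; apply: eq_bigr => j _; rewrite rmorphB rmorphM rmorphXn.
Qed.

Lemma qpoch_qprod (F : fieldType) (x p : F) k : qpoch x p k = qprod x 1 p k.
Proof. by []. Qed.

Lemma qpoch_div (F : fieldType) (x y p : F) k :
  y != 0 -> qpoch (x / y) p k = qprod x y p k / y ^+ k.
Proof.
move=> y0; elim: k => [|k IH]; first by rewrite qpoch0 /qprod big_ord0 expr0 divr1.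
rewrite qpochSr IH /qprod big_ord_recr /= exprSr invfM.
have yk0 : y ^+ k != 0 by rewrite expf_neq0.
by move: (_ ^+ k) yk0 (p ^+ k) => u u0 v; field; rewrite u0 y0.
Qed.

Lemma qprod_neq0 (F : fieldType) (x y p : F) k :
  (forall j, (j < k)%N -> x * p ^+ j != y) -> qprod x y p k != 0.
Proof.
by move=> h; apply/prodf_neq0 => i _; rewrite subr_eq0 eq_sym; apply: h.
Qed.

Definition sterm (F : fieldType) (q a e : F) (d k : nat) : F :=
  qint q (3 * d * k + 1)
  * ((qpochs [:: q; e; q ^+ (1 + d) / e] (q ^+ (2 * d)) k
      * qpochs [:: a * q; q / a; q ^+ (d - 1)] (q ^+ d) k)
     / (qpochs [:: q ^+ d; e; q ^+ (1 + d) / e] (q ^+ d) k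
        * qpochs [:: a * q ^+ (2 * d); q ^+ (2 * d) / a; q ^+ (d + 2)]
            (q ^+ (2 * d)) k))
  * q ^+ (d * k).

Definition sterm_num (R : comPzRingType) (q a e : R) (d k : nat) : R :=
  (1 - q ^+ (3 * d * k + 1))
  * (qprod q 1 (q ^+ (2 * d)) k * qprod e 1 (q ^+ (2 * d)) k
     * qprod (q ^+ (1 + d)) e (q ^+ (2 * d)) k
     * (qprod (a * q) 1 (q ^+ d) k * qprod q a (q ^+ d) k
        * qprod (q ^+ (d - 1)) 1 (q ^+ d) k))
  * q ^+ (d * k).

Definition sterm_den (R : comPzRingType) (q a e : R) (d k : nat) : R :=
  (1 - q)
  * (qprod (q ^+ d) 1 (q ^+ d) k * qprod e 1 (q ^+ d) k
     * qprod (q ^+ (1 + d)) e (q ^+ d) k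
     * (qprod (a * q ^+ (2 * d)) 1 (q ^+ (2 * d)) k
        * qprod (q ^+ (2 * d)) a (q ^+ (2 * d)) k
        * qprod (q ^+ (d + 2)) 1 (q ^+ (2 * d)) k)).

Lemma rmorph_sterm_num (R S : comPzRingType) (h : {rmorphism R -> S}) q a e d k :
  h (sterm_num q a e d k) = sterm_num (h q) (h a) (h e) d k.
Proof.
by rewrite !(rmorphM, rmorphB, rmorph_qprod, rmorph1, rmorphXn).
Qed.

Lemma rmorph_sterm_den (R S : comPzRingType) (h : {rmorphism R -> S}) q a e d k :
  h (sterm_den q a e d k) = sterm_den (h q) (h a) (h e) d k.
Proof.
by rewrite !(rmorphM, rmorphB, rmorph_qprod, rmorph1, rmorphXn).
Qed.

(** No power of [a] or [e] is left over: [q / a] and [q^(2 d) / a] contribute [a^k] to opposite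
    sides of the fraction, and [q^(1+d) / e] contributes [e^k] to both. *)
Lemma sterm_div (F : fieldType) (q a e : F) d k :
  a != 0 -> e != 0 ->
  sterm q a e d k = sterm_num q a e d k / sterm_den q a e d k.
Proof.
move=> a0 e0; rewrite /sterm /sterm_num /sterm_den /qint /qpochs !big_cons !big_nil.
rewrite !(qpoch_div _ _ _ a0) !(qpoch_div _ _ _ e0) !qpoch_qprod !mulr1 !invfM !invrK.
have ak0 : a ^+ k != 0 by rewrite expf_neq0.
have ek0 : e ^+ k != 0 by rewrite expf_neq0.
move: (qprod (q ^+ d) _ _ _)^-1 (qprod e _ (q ^+ d) _)^-1
  (qprod (q ^+ (1 + d)) _ (q ^+ d) _)^-1 (qprod (a * q ^+ (2 * d)) _ _ _)^-1
  (qprod (q ^+ (2 * d)) _ _ _)^-1 (qprod (q ^+ (d + 2)) _ _ _)^-1 (1 - q)^-1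
  => X1 X2 X3 X4 X5 X6 X7.
move: (a ^+ k) (e ^+ k) ak0 ek0 => u v u0 v0.
move: (qprod _ _ _ _) (qprod _ _ _ _) (qprod _ _ _ _) (qprod _ _ _ _)
  (qprod _ _ _ _) (qprod _ _ _ _) (q ^+ (d * k)) (q ^+ _)=> Y1 Y2 Y3 Y4 Y5 Y6 Y7 Y8.
by field; rewrite u0 v0.
Qed.

(** Used to bring [a q] into the slot of [b]. *)
Lemma rterm_rot (F : fieldType) (p al b c g e f : F) k :
  rterm p al b c g e f k = rterm p al c g b e f k.
Proof.
rewrite /rterm (mulrC g b) (mulrC c b).
congr (_ * (_ / _) * _); ring.
Qed.

Lemma sterm_rterm (F : fieldType) (q a e : F) d k :
  (0 < d)%N -> a != 0 ->
  sterm q a e d k = (1 - q)^-1 *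
    rterm (q ^+ d) q (q ^+ (d - 1)) (a * q) (q / a) e (q ^+ (1 + d) / e) k.
Proof.
move=> d0 a0; rewrite /sterm /rterm /qint /qpochs !big_cons !big_nil.
have -> : a * q * (q / a) * q ^+ d = q ^+ (d + 2) by rewrite exprD; field.
have -> : q ^+ (d - 1) * (q / a) * q ^+ d = q ^+ (2 * d) / a.
  have -> : (2 * d = (d - 1).+1 + d)%N by lia.
  by rewrite exprD exprSr; field.
have -> : q ^+ (d - 1) * (a * q) * q ^+ d = a * q ^+ (2 * d).
  have -> : (2 * d = (d - 1).+1 + d)%N by lia.
  by rewrite exprD exprSr; ring.
have -> : q ^+ (3 * d * k + 1) = q * (q ^+ d) ^+ (3 * k).
  by rewrite -exprM -exprS; congr (_ ^+ _); lia.
rewrite -!exprM (mulnC d 2) !mulr1 !invfM.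
move: (qpoch _ _ _)^-1 (qpoch _ _ _)^-1 (qpoch _ _ _)^-1 (qpoch _ _ _)^-1
  (qpoch _ _ _)^-1 (qpoch _ _ _)^-1 (1 - q)^-1 => X1 X2 X3 X4 X5 X6 X7.
ring.
Qed.

(** Reduces [a = q^n] to [a = q^-n]. *)
Lemma sterm_inv (F : fieldType) (q a e : F) d k :
  sterm q a^-1 e d k = sterm q a e d k.
Proof.
rewrite /sterm /qpochs !big_cons !big_nil invrK.
rewrite (mulrC a^-1) (mulrC q a) (mulrC a^-1) (mulrC (q ^+ (2 * d)) a).
congr (_ * (_ / _) * _); ring.
Qed.

Lemma eq_divLR (F : fieldType) (x y z : F) :
  y != 0 -> (x / y == z) = (x == z * y).
Proof.
move=> y0; apply/eqP/eqP => [<-|->]; first by rewrite divfK.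
by rewrite mulfK.
Qed.

Lemma sterm_den_neq0 (F : fieldType) (q a e : F) d k :
  q != 1 -> (forall j, (j < k)%N -> q ^+ (d * j.+1) != 1) ->
  (forall j, (j < k)%N -> q ^+ (d + 2 + 2 * d * j) != 1) ->
  (forall j, a * q ^+ (2 * d * j.+1) != 1) ->
  (forall j, q ^+ (2 * d * j.+1) != a) ->
  (forall i j, q ^+ i != e * q ^+ j) ->
  sterm_den q a e d k != 0.
Proof.
move=> q1 hd hd2 ha ha' he.
have e1 j : e * q ^+ j != 1 by rewrite eq_sym -(expr0 q).
have X m i j : q ^+ m * (q ^+ i) ^+ j = q ^+ (m + i * j) by rewrite -exprM -exprD.
rewrite !mulf_neq0 //; try (apply: qprod_neq0 => j jk).
- by rewrite subr_eq0 eq_sym.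
- by rewrite X -mulnS hd.
- by rewrite -exprM e1.
- by rewrite X -[e]mulr1 -(expr0 q) he.
- by rewrite -mulrA X -mulnS ha.
- by rewrite X -mulnS ha'.
- by rewrite X hd2.
Qed.

(** * Vanishing of the sum at special values of [q] or [a] *)

(** The case [al p^(2 M) = 1] of Rahman's series, with [al = q] and [p = q^d]. *)
Lemma sum_sterm_eq0_root (F : fieldType) (q a e : F) d M :
  (0 < d)%N -> a != 0 -> e != 0 -> q ^+ (1 + 2 * d * M) = 1 ->
  (forall j, (j < M)%N -> q ^+ (d * j.+1) != 1) ->
  (forall j, (j < M)%N -> q ^+ (d + 2 + 2 * d * j) != 1) ->
  (forall i j, q ^+ i != a * q ^+ j) ->
  (forall i j, q ^+ i != e * q ^+ j) ->
  \sum_(0 <= k < M.+1) sterm q a e d k = 0.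
Proof.
move=> d0 a0 e0 qM hd hd2 ha he.
have X m i j : q ^+ m * (q ^+ i) ^+ j = q ^+ (m + i * j) by rewrite -exprM -exprD.
have q0 : q != 0.
  by apply: contra_eq_neq qM => ->; rewrite add1n expr0n eq_sym oner_eq0.
have qd : q ^+ d = q ^+ (d - 1) * q by rewrite -exprSr; congr (_ ^+ _); lia.
under eq_bigr do rewrite (sterm_rterm _ _ _ d0 a0).
rewrite -mulr_sumr rahman_sum_eq0_al ?mulr0 //.
- by rewrite qd; field.
- by rewrite exprD qd; field; rewrite e0 a0.
- by rewrite -{1}[q]expr1 X mulnA (mulnC d).
- by move=> j jM; rewrite X -mulnS hd.
- by move=> j; rewrite -exprM eq_sym -(expr0 q) he.
- by move=> j; rewrite mulrAC X (eq_divLR _ _ e0) mulrC -(expr0 q) he.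
- move=> j jM; have -> : a * q * (q / a) * q ^+ d = q ^+ (d + 2) by rewrite exprD; field.
  by rewrite -!exprM -exprD mulnA (mulnC d 2%N) hd2.
- move=> j; have -> : q ^+ (d - 1) * (q / a) * q ^+ d = q ^+ d * q ^+ d / a.
    by rewrite qd; field.
  by rewrite mulrAC -!exprM -!exprD (eq_divLR _ _ a0) mulrC -(expr0 q) ha.
- move=> j; have -> : q ^+ (d - 1) * (a * q) * q ^+ d = a * (q ^+ d * q ^+ d).
    by rewrite qd; ring.
  by rewrite -mulrA -!exprM -!exprD eq_sym -(expr0 q) ha.
- move=> j; have -> : a * q * (q / a) = q ^+ 2 by field.
  by rewrite mulrAC X (eq_divLR _ _ e0) mulrC he.
Qed.

Lemma exp_inj (F : fieldType) (q : F) :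
  q != 0 -> (forall j, (0 < j)%N -> q ^+ j != 1) -> injective (GRing.exp q).
Proof.
move=> q0 hq j l; wlog jl : j l / (j <= l)%N.
  by move=> W; case/orP: (leq_total j l) => h /esym; [move/esym; exact: W | move/(W _ _ h)].
rewrite -(subnKC jl) exprD -{1}[q ^+ j]mulr1 => /(mulfI (expf_neq0 _ q0)) q1.
by case: (posnP (l - j)) => [|/hq]; [lia | rewrite -q1 eqxx].
Qed.

(** After the rotation [b = a q], so [b p^(2 i + 1) = a q^n = 1]. *)
Lemma sum_sterm_eq0_aqn (F : fieldType) (q a e : F) d i n K :
  (0 < d)%N -> ~~ odd d -> n = (d * (2 * i + 1)).+1 -> (2 * i < K)%N ->
  a * q ^+ n = 1 -> e != 0 -> (forall j, (0 < j)%N -> q ^+ j != 1) ->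
  (forall i j, q ^+ i != e * q ^+ j) ->
  \sum_(0 <= k < K.+1) sterm q a e d k = 0.
Proof.
move=> d0 d_even en iK aqn e0 hq he.
have X m l j : q ^+ m * (q ^+ l) ^+ j = q ^+ (m + l * j) by rewrite -exprM -exprD.
have a0 : a != 0 by apply: contra_eq_neq aqn => ->; rewrite mul0r eq_sym oner_eq0.
have q0 : q != 0.
  by apply: contra_eq_neq aqn => ->; rewrite en expr0n mulr0 eq_sym oner_eq0.
(* The denominator factors [1 - a q^j] have even [j], whereas [a = q^-n] with [n] odd, so none of
   them vanishes. *)
have n_odd : odd n by rewrite en /= oddM negb_and d_even.
have inj := exp_inj q0 hq.
have qd : q ^+ d = q ^+ (d - 1) * q by rewrite -exprSr; congr (_ ^+ _); lia.
have aj j : ~~ odd j -> a * q ^+ j != 1.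
  move=> j_even; apply/eqP; rewrite -aqn => /(mulfI a0)/inj jn.
  by move: j_even; rewrite jn n_odd.
have ja j : (0 < j)%N -> q ^+ j != a.
  move=> j0; apply/eqP => ja; move: aqn; rewrite -ja -exprD => /eqP.
  by apply/negP/hq; rewrite addn_gt0 j0.
under eq_bigr do rewrite (sterm_rterm _ _ _ d0 a0) rterm_rot.
rewrite -mulr_sumr (rahman_sum_eq0_b (i := i)) ?mulr0 //.
- by rewrite qd; field.
- by rewrite exprD qd; field; rewrite e0 a0.
- by rewrite -mulrA -exprM -exprS -en.
- by move=> j jM; rewrite X -mulnS hq // muln_gt0 d0.
- by move=> j; rewrite -exprM eq_sym -(expr0 q) he.
- by move=> j; rewrite mulrAC X (eq_divLR _ _ e0) mulrC -(expr0 q) he.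
- move=> j _; have -> : q / a * q ^+ (d - 1) * q ^+ d = q ^+ d * q ^+ d / a.
    by rewrite qd; field.
  rewrite mulrAC -!exprM -!exprD (eq_divLR _ _ a0) mul1r ja //.
  by rewrite addn_gt0 addn_gt0 d0.
- move=> j; have -> : a * q * q ^+ (d - 1) * q ^+ d = a * (q ^+ d * q ^+ d).
    by rewrite qd; ring.
  rewrite -mulrA -!exprM -!exprD aj //.
  by rewrite oddD addnn odd_double oddM oddM (negbTE d_even).
- move=> j; have -> : a * q * (q / a) * q ^+ d = q ^+ (d + 2) by rewrite exprD; field.
  by rewrite -!exprM -exprD hq // addn2.
move=> j; have -> : q / a * q ^+ (d - 1) = q ^+ (d + n).
  by rewrite (_ : a^-1 = q ^+ n) 1?exprD ?qd; [ring | apply: (mulfI a0); rewrite aqn divff].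
by rewrite mulrAC X (eq_divLR _ _ e0) mulrC he.
Qed.

(** [N] and [D] are fixed before the field and the morphism: one common-denominator form serves all
    evaluations. *)
Lemma ex_sum_frac (R : pzRingType) (A B : nat -> R) K :
  exists N D, forall (F : fieldType) (h : {rmorphism R -> F}),
    (forall k, (k < K)%N -> h (B k) != 0) ->
    h D != 0 /\ \sum_(0 <= k < K) h (A k) / h (B k) = h N / h D.
Proof.
elim: K => [|K [N [D IH]]].
  exists 0, 1 => F h _; rewrite big_nil rmorph0 rmorph1 mul0r.
  by split; rewrite ?oner_eq0.
exists (N * B K + A K * D), (D * B K) => F h hB.
have [|D0 sumK] := IH F h; first by move=> k kK; apply/hB/ltnW.
have BK0 := hB K (ltnSn K).
rewrite rmorphM mulf_neq0 //; split=> //.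
by rewrite big_nat_recr //= sumK rmorphD !rmorphM; field; rewrite D0 BK0.
Qed.

(** * Evaluation of [q] and [a] with [e] kept generic *)

Section Evaluation.

Variables (B : idomainType) (v : {rmorphism {poly {poly int}} -> B}).

(** [v] specializes [q] and [a] only; passing to fractions gives the field target needed for
    primality. *)
Definition evale : Zqae -> {fraction {poly B}} := @tofrac _ \o map_poly v.

HB.instance Definition _ := GRing.RMorphism.on evale.

Definition cst : B -> {fraction {poly B}} := @tofrac _ \o polyC.

HB.instance Definition _ := GRing.RMorphism.on cst.

Lemma cst_inj : injective cst.
Proof. by move=> x y /eqP; rewrite tofrac_eq => /eqP/polyC_inj. Qed.

Lemma cst_eq x y : (cst x == cst y) = (x == y).
Proof. exact: inj_eq cst_inj _ _. Qed.

Lemma cst_eq0 x : (cst x == 0) = (x == 0).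
Proof. by rewrite -(rmorph0 cst) cst_eq. Qed.

Lemma cst_eq1 x : (cst x == 1) = (x == 1).
Proof. by rewrite -(rmorph1 cst) cst_eq. Qed.

Lemma evaleC c : evale c%:P = cst (v c).
Proof. by rewrite /evale /= map_polyC. Qed.

Lemma evale_q : evale qX = cst (v 'X%:P).
Proof. exact: evaleC. Qed.

Lemma evale_a : evale aX = cst (v 'X).
Proof. exact: evaleC. Qed.

Lemma evale_e : evale eX = tofrac 'X.
Proof. by rewrite /evale /= map_polyX. Qed.

(** A multiple of [e] has zero constant coefficient. *)
Lemma cst_neq_e x y : x != 0 -> cst x != evale eX * cst y.
Proof.
move=> x0; rewrite evale_e /cst /= -tofracM tofrac_eq; apply: contraNneq x0.
by move=> /(congr1 (coefp 0)) /=; rewrite coefC coefXM /= => ->.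
Qed.

Lemma evale_e_neq0 : evale eX != 0.
Proof. by rewrite evale_e tofrac_eq0 polyX_eq0. Qed.

Lemma kernel_generator_evale x :
  kernel_generator v x -> kernel_generator evale x%:P.
Proof.
move=> /kernel_generator_map_poly; apply: kernel_generator_inj.
by move=> y z /eqP; rewrite tofrac_eq => /eqP.
Qed.

End Evaluation.

(** * Arithmetic of the exponents and the specialized sums *)

(** The division defining the upper limit [M] is exact: [2 d M = d n + n - 1]. *)
Lemma divn_bound_even d n (hd : (2 <= d)%N) (d_even : ~~ odd d)
    (n_gt0 : (0 < n)%N) (hn : (n = d + 1 %[mod 2 * d])%N) :
  exists h m, [/\ (0 < h)%N, d = (2 * h)%N, n = (4 * h * m + 2 * h + 1)%N
    & ((d * n + n - 1) %/ (2 * d) = 2 * h * m + h + 1 + m)%N].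
Proof.
have dE : d = (2 * d./2)%N by rewrite mul2n even_halfK.
move: (d./2) dE => h dE; exists h, (n %/ (2 * d))%N.
have h0 : (0 < h)%N by lia.
have nE : n = (4 * h * (n %/ (2 * d)) + 2 * h + 1)%N.
  have := divn_eq n (2 * d); rewrite hn modn_small; last by lia.
  by move=> {1}->; rewrite dE; lia.
move: (n %/ (2 * d))%N nE => m nE; split=> //.
have -> : (d * n + n - 1 = (2 * h * m + h + 1 + m) * (2 * d))%N by rewrite nE dE; nia.
by rewrite mulnK //; lia.
Qed.

(** [n] is coprime to [2] and to [h], and [M < n]; this settles the first exponent and halves the
    second. *)
Lemma prim_root_neq1 (F : fieldType) (z : F) h m :
  let n := (4 * h * m + 2 * h + 1)%N in
  let M := (2 * h * m + h + 1 + m)%N in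
  n.-primitive_root z -> (0 < h)%N ->
  forall j, (j < M)%N ->
    z ^+ (2 * h * j.+1) != 1 /\ z ^+ (2 * h + 2 + 2 * (2 * h) * j) != 1.
Proof.
move=> n M pz h0 j jM; rewrite -!(prim_order_dvd pz).
have n2 : coprime n 2 by rewrite coprimen2 /n; lia.
have nh : coprime n h.
  have -> : n = ((4 * m + 2) * h + 1)%N by rewrite /n; nia.
  by rewrite coprime_sym /coprime gcdnMDl gcdn1.
split.
  rewrite -mulnA !Gauss_dvdr //.
  by apply/negP => /dvdn_leq; rewrite /n; move: jM; rewrite /M; nia.
have -> : (2 * h + 2 + 2 * (2 * h) * j = 2 * (h + 1 + 2 * h * j))%N by nia.
rewrite Gauss_dvdr //; apply/negP => /dvdnP [t].
move: jM; rewrite /n /M => jM et.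
(* From [t n = h + 1 + 2 h j]: the bound [j < M] excludes [t > h], and since [n = 1] modulo [2 h],
   [t] is [h + 1] modulo [2 h], which excludes [0 < t <= h]. *)
have [th|th] := leqP t h; last by nia.
have [jt|jt] := leqP (t * (2 * m + 1))%N j.
  by nia.
by nia.
Qed.

Lemma sterm_cyclotomic (F : fieldType) (z a e : F) h m :
  let d := (2 * h)%N in
  let n := (4 * h * m + 2 * h + 1)%N in
  let M := (2 * h * m + h + 1 + m)%N in
  (0 < h)%N -> n.-primitive_root z -> a != 0 -> e != 0 ->
  (forall i j, z ^+ i != a * z ^+ j) -> (forall i j, z ^+ i != e * z ^+ j) ->
  \sum_(0 <= k < M.+1) sterm z a e d k = 0 /\
  forall k, (k < M.+1)%N -> sterm_den z a e d k != 0.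
Proof.
move=> d n M h0 pz a0 e0 ha he; have zj := prim_root_neq1 pz h0.
have d0 : (0 < d)%N by rewrite muln_gt0.
split=> [|k kM].
  apply: sum_sterm_eq0_root => // [|j /zj []|j /zj []] //.
  (* The cofactor comes from [1 + 2 d M = (d + 1) n]. *)
  apply/eqP; rewrite -(prim_order_dvd pz); apply/dvdnP; exists (d + 1)%N.
  by rewrite /d /M /n; nia.
apply: sterm_den_neq0 => //.
- rewrite -(expr1 z) -(prim_order_dvd pz) dvdn1 /n; lia.
- by move=> j jk; have [] := zj j (leq_trans jk kM).
- by move=> j jk; have [] := zj j (leq_trans jk kM).
- by move=> j; rewrite eq_sym -(expr0 z) ha.
- by move=> j; rewrite -[a]mulr1 -(expr0 z) ha.
Qed.

Lemma sterm_aqn (F : fieldType) (q a e : F) h m :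
  let d := (2 * h)%N in
  let n := (4 * h * m + 2 * h + 1)%N in
  let M := (2 * h * m + h + 1 + m)%N in
  (0 < h)%N -> a * q ^+ n = 1 \/ a = q ^+ n -> q != 0 -> e != 0 ->
  (forall j, (0 < j)%N -> q ^+ j != 1) -> (forall i j, q ^+ i != e * q ^+ j) ->
  \sum_(0 <= k < M.+1) sterm q a e d k = 0 /\
  forall k, (k < M.+1)%N -> sterm_den q a e d k != 0.
Proof.
move=> d n M h0 aq q0 e0 hq he.
have d0 : (0 < d)%N by rewrite muln_gt0.
have d_even : ~~ odd d by rewrite /d mul2n odd_double.
have qn0 : q ^+ n != 0 by rewrite expf_neq0.
have sum0 b : b * q ^+ n = 1 -> \sum_(0 <= k < M.+1) sterm q b e d k = 0.
  (* [i] is [m] because [n = d (2 m + 1) + 1], and [2 m < M]. *)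
  by move=> bq; apply: (sum_sterm_eq0_aqn (i := m) (n := n)) => //; rewrite /n /d /M; nia.
have inj := exp_inj q0 hq.
have evn j : 2 * d * j <> n by move/(congr1 odd); rewrite /n /d; lia.
split=> [|k kM].
  case: aq => [/sum0 //|an].
  under eq_bigr do rewrite -sterm_inv.
  by apply: sum0; rewrite an mulVf.
apply: sterm_den_neq0 => // [|j jk|j jk|j|j].
- by rewrite -(expr1 q) hq.
- by rewrite hq // muln_gt0 d0.
- by rewrite hq // addnAC addn2.
- case: aq => [aq|->].
    have a0 : a != 0 by apply: contra_eq_neq aq => ->; rewrite mul0r eq_sym oner_eq0.
    by rewrite -aq; apply/eqP => /(mulfI a0)/inj/evn.
  by rewrite -exprD; apply: hq; rewrite /n addn1 addSn.
case: aq => [aq|->]; last by apply/eqP => /inj/evn.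
apply/eqP => ja; move: aq; rewrite -ja -exprD => /eqP; apply/negP/hq.
by rewrite addn_gt0 muln_gt0 muln_gt0 d0.
Qed.

(** * Assembly of the congruence *)

Lemma eq_tofrac_div (R : idomainType) (x y z t : R) :
  y != 0 -> t != 0 -> x * t = z * y -> tofrac x / tofrac y = tofrac z / tofrac t.
Proof.
move=> y0 t0 xt; apply/eqP; rewrite eqr_div ?tofrac_eq0 //.
by rewrite -!tofracM xt.
Qed.

Theorem theorem2p1 (d n : nat) (hd : (2 <= d)%N) (d_even : ~~ odd d)
    (n_gt0 : (0 < n)%N) (hn : (n = d + 1 %[mod 2 * d])%N) :
  let q : ratfun := tofrac qX in
  let a : ratfun := tofrac aX in
  let e : ratfun := tofrac eX in
  congr_mod (Phi n * (1 - aX * qX ^+ n) * (aX - qX ^+ n))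
    (\sum_(0 <= k < ((d * n + n - 1) %/ (2 * d)).+1)
       qint q (3 * d * k + 1)
       * ((qpochs [:: q; e; q ^+ (1 + d) / e] (q ^+ (2 * d)) k
           * qpochs [:: a * q; q / a; q ^+ (d - 1)] (q ^+ d) k)
          / (qpochs [:: q ^+ d; e; q ^+ (1 + d) / e] (q ^+ d) k
             * qpochs [:: a * q ^+ (2 * d); q ^+ (2 * d) / a; q ^+ (d + 2)]
                 (q ^+ (2 * d)) k))
       * q ^+ (d * k))
    0.
Proof.
move=> q a e.
have [h [m [h0 dE nE ->]]] := divn_bound_even hd d_even n_gt0 hn.
set M := (_ + m)%N.
rewrite (_ : \sum_(0 <= k < M.+1) _ = \sum_(0 <= k < M.+1) sterm q a e d k) //.
have [N0 [D0 frac]] := ex_sum_frac (sterm_num qX aX eX d) (sterm_den qX aX eX d) M.+1.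
have {}frac (F : fieldType) (f : {rmorphism Zqae -> F}) :
    f aX != 0 -> f eX != 0 ->
    (forall k, (k < M.+1)%N -> sterm_den (f qX) (f aX) (f eX) d k != 0) ->
    f D0 != 0 /\ \sum_(0 <= k < M.+1) sterm (f qX) (f aX) (f eX) d k = f N0 / f D0.
  move=> a0 e0 den; have [|D0n <-] := frac F f.
    by move=> k kM; rewrite rmorph_sterm_den den.
  split=> //; apply: eq_bigr => k _.
  by rewrite rmorph_sterm_num rmorph_sterm_den sterm_div.
have vanish (F : fieldType) (f : {rmorphism Zqae -> F}) :
    f aX != 0 -> f eX != 0 ->
    \sum_(0 <= k < M.+1) sterm (f qX) (f aX) (f eX) d k = 0 /\
    (forall k, (k < M.+1)%N -> sterm_den (f qX) (f aX) (f eX) d k != 0) ->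
    f N0 = 0 /\ f D0 != 0.
  move=> a0 e0 [sum0 den]; have [D0n] := frac F f a0 e0 den.
  rewrite sum0 => /esym/eqP; rewrite mulf_eq0 invr_eq0 (negbTE D0n) orbF.
  by move/eqP.
have [z pz] := C_prim_root_exists n_gt0.
have z0 : z != 0.
  by apply: contra_eq_neq (prim_expr_order pz) => ->; rewrite expr0n eqn0Ngt n_gt0 eq_sym oner_eq0.
(* [v1] sets [q = z] and keeps [a] free; [v2] and [v3] keep [q] free and set [a = q^n] and
   [a = q^-n]. *)
pose w : {rmorphism {poly int} -> algC} :=
  (horner_eval z \o map_poly (intr : int -> algC)).
pose v1 : {rmorphism {poly {poly int}} -> {poly algC}} := map_poly w.
pose u : {rmorphism {poly int} -> {fraction {poly int}}} := @tofrac {poly int}.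
have u_inj : injective u by move=> x y /eqP; rewrite tofrac_eq => /eqP.
pose v2 : {rmorphism {poly {poly int}} -> {fraction {poly int}}} :=
  (horner_eval (u 'X^n) \o map_poly u).
pose v3 : {rmorphism {poly {poly int}} -> {fraction {poly int}}} :=
  (horner_eval (u 'X^n)^-1 \o map_poly u).
have k1 : kernel_generator (evale v1) (Phi n).
  apply/kernel_generator_evale/kernel_generator_map_poly.
  exact: kernel_generator_Cyclotomic.
have k2 : kernel_generator (evale v2) (aX - qX ^+ n).
  have -> : aX - qX ^+ n = ('X - ('X^n)%:P)%:P by rewrite /aX /qX !rmorphB !rmorphXn.
  exact/kernel_generator_evale/kernel_generator_eval.
have aqnE : 1 - aX * qX ^+ n = (1 - ('X^n)%:P * 'X)%:P.
  by rewrite /aX /qX rmorphB rmorph1 rmorphM !rmorphXn mulrC.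
have k3 : kernel_generator (evale v3) (1 - aX * qX ^+ n).
  rewrite aqnE; apply: kernel_generator_evale; apply: kernel_generator_eval_inv => //.
  by rewrite monic_neq0 ?monicXn.
have v1q : v1 'X%:P = z%:P.
  by rewrite /v1 /w /= map_polyC /= map_polyX /horner_eval hornerX.
have v1a : v1 'X = 'X by rewrite /v1 /= map_polyX.
have v2q : v2 'X%:P = u 'X by rewrite /v2 /= map_polyC /horner_eval hornerC.
have v3q : v3 'X%:P = u 'X by rewrite /v3 /= map_polyC /horner_eval hornerC.
have v2a : v2 'X = u 'X^n by rewrite /v2 /= map_polyX /horner_eval hornerX.
have v3a : v3 'X = (u 'X^n)^-1 by rewrite /v3 /= map_polyX /horner_eval hornerX.
have ux0 : u 'X != 0 by rewrite tofrac_eq0 polyX_eq0.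
have uxn0 : u 'X^n != 0 by rewrite rmorphXn expf_neq0.
have uxj j : (0 < j)%N -> u 'X ^+ j != 1.
  move=> j0; rewrite -rmorphXn -(rmorph1 u) (inj_eq u_inj).
  apply/eqP => /(congr1 (@size _ \o polyseq)) /=.
  by rewrite size_polyXn size_poly1; case: j j0.
have v2C c : v2 c%:P = u c by rewrite /v2 /= map_polyC /horner_eval hornerC.
have v3C c : v3 c%:P = u c by rewrite /v3 /= map_polyC /horner_eval hornerC.
(* Only the recorded facts about these morphisms are used from here on. *)
clearbody v1 v2 v3 u.
have e_gen (B : idomainType) (v : {rmorphism {poly {poly int}} -> B}) :
    v 'X%:P != 0 -> forall i j, evale v qX ^+ i != evale v eX * evale v qX ^+ j.
  by move=> vq0 i j; rewrite evale_q -!rmorphXn cst_neq_e // !rmorphXn expf_neq0.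
have a1 : evale v1 aX != 0 by rewrite evale_a cst_eq0 v1a polyX_eq0.
have [sum1 den1] : \sum_(0 <= k < M.+1) sterm (evale v1 qX) (evale v1 aX) (evale v1 eX) d k = 0
    /\ forall k, (k < M.+1)%N -> sterm_den (evale v1 qX) (evale v1 aX) (evale v1 eX) d k != 0.
  rewrite dE.
  apply: (sterm_cyclotomic h0 _ a1 (evale_e_neq0 v1)).
  - by rewrite -nE evale_q v1q (fmorph_primitive_root (@cst _ \o polyC)).
  - move=> i j; rewrite evale_q evale_a v1q v1a -!rmorphXn -rmorphM cst_eq.
    apply/eqP => /(congr1 (coefp 0)) /=; rewrite coefC coefXM /= => /eqP.
    by rewrite (negbTE (expf_neq0 _ z0)).
  - by apply: e_gen; rewrite v1q polyC_eq0.
have [n1 d1] := vanish _ (evale v1) a1 (evale_e_neq0 v1) (conj sum1 den1).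
have van (v : {rmorphism {poly {poly int}} -> {fraction {poly int}}}) :
    v 'X%:P = u 'X -> v 'X * u 'X^n = 1 \/ v 'X = u 'X^n ->
    evale v N0 = 0 /\ evale v D0 != 0.
  move=> vq va; have va0 : v 'X != 0.
    by case: va => [|-> //]; apply: contra_eq_neq => ->; rewrite mul0r eq_sym oner_eq0.
  have a0 : evale v aX != 0 by rewrite evale_a cst_eq0.
  have e0 := evale_e_neq0 v.
  suff sum_den : \sum_(0 <= k < M.+1) sterm (evale v qX) (evale v aX) (evale v eX) d k = 0
      /\ forall k, (k < M.+1)%N -> sterm_den (evale v qX) (evale v aX) (evale v eX) d k != 0.
    exact: vanish _ (evale v) a0 e0 sum_den.
  rewrite dE; apply: (sterm_aqn h0 _ _ e0); rewrite -?nE.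
  - rewrite evale_q evale_a vq -rmorphXn -rmorphM -rmorphXn.
    by case: va => ->; [left; rewrite rmorph1 | right].
  - rewrite evale_q cst_eq0 vq; exact: ux0.
  - move=> j j0; rewrite evale_q vq -rmorphXn cst_eq1.
    exact: uxj.
  - apply: e_gen; rewrite vq; exact: ux0.
have [n2 d2] := van v2 v2q (or_intror v2a).
have v3n : v3 'X * u 'X^n = 1 by rewrite v3a; exact: mulVf uxn0.
have [n3 d3] := van v3 v3q (or_introl v3n).
have Phi0 (v : {rmorphism {poly {poly int}} -> {fraction {poly int}}}) :
    (forall c, v c%:P = u c) -> evale v (Phi n) != 0.
  move=> vC; rewrite /evale /= map_polyC /= tofrac_eq0 polyC_eq0 vC.
  by rewrite -(rmorph0 u) (inj_eq u_inj) monic_neq0 ?Cyclotomic_monic.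
(* At [a = q^n] this factor becomes [1 - q^(2 n)]. *)
have Q0 : evale v2 (1 - aX * qX ^+ n) != 0.
  rewrite aqnE evaleC cst_eq0 rmorphB rmorph1 rmorphM v2C v2a subr_eq0 eq_sym.
  by rewrite -rmorphM -exprD rmorphXn; apply: uxj; rewrite addn_gt0 n_gt0.
(* The evaluations are ordered as the factors of the modulus, hence [v3] before [v2]. *)
have [||N [D [D_neq0 ND nc dP ncP]]] :=
  reduced_form_mod_prod3 (size_like_poly (size_like_poly (size_like_poly size_like_absz)))
    k1 k3 k2 (Phi0 _ v3C) _ _ n1 n3 n2 d1 d3 d2.
- by rewrite rmorphM; apply: mulf_neq0 (Phi0 _ v2C) Q0.
- have -> : aX - qX ^+ n = ('X - ('X^n)%:P)%:P by rewrite /aX /qX !rmorphB !rmorphXn.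
  by rewrite polyC_eq0 polyXsubC_eq0.
exists N, D; split=> //.
(* For the canonical embedding, the same [N0] and [D0] represent the original sum. *)
have [] := frac _ (@tofrac Zqae).
- by rewrite tofrac_eq0 polyC_eq0 polyX_eq0.
- by rewrite tofrac_eq0 polyX_eq0.
(* A denominator equal to zero in [Z[q, a, e]] would also vanish under [evale v1]. *)
- move=> k kM; rewrite -rmorph_sterm_den tofrac_eq0; move: (den1 k kM).
  by rewrite -rmorph_sterm_den; apply: contraNneq => ->; rewrite rmorph0.
move=> D00 ->; rewrite subr0.
apply: eq_tofrac_div D_neq0 ND.
by move: D00; rewrite tofrac_eq0.
Qed.
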